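(* Given two distinct points $x,y\in\mathbb{B}^n$, let $J[x,y]$ be the hyperbolic segment joining $x$ and $y$. Let $L_{xy}$ be the hyperbolic bisector of $J[x,y]$ with two endpoints $u$ and $w$ in $\partial\mathbb{B}^n$. Then one of the endpoints $u$ and $w$ is the extremal point for $v_{\mathbb{B}^n}(x,y)$, specifically: (i) if $x$ and $y$ are symmetric with respect to the origin $0$, then $v_{\mathbb{B}^n}(x,y)=\measuredangle(x,u,y)=\measuredangle(x,w,y)$; (ii) if $x$ and $y$ are not symmetric with respect to the origin $0$, then $v_{\mathbb{B}^n}(x,y)=\max\{\measuredangle(x,u,y),\measuredangle(x,w,y)\}$.
   Context: Here $n\ge 2$ and $\mathbb{B}^n=\{z\in\mathbb{R}^n:|z|<1\}$ is the unit ball with the hyperbolic metric $\rho_{\mathbb{B}^n}$ given by $\sinh\frac{\rho_{\mathbb{B}^n}(x,y)}{2}=\frac{|x-y|}{\sqrt{(1-|x|^2)(1-|y|^2)}}$. Hyperbolic geodesic lines are arcs of circles (or diameters) orthogonal to $\partial\mathbb{B}^n$. The hyperbolic segment $J[x,y]$ is the part between $x$ and $y$ of the hyperbolic geodesic line through $x$ and $y$. The hyperbolic bisector of $J[x,y]$ is the hyperbolic geodesic line through the hyperbolic midpoint of $J[x,y]$ orthogonal to $J[x,y]$. For distinct points $x,y,z\in\mathbb{R}^n$, $\measuredangle(x,z,y)\in[0,\pi]$ denotes the angle between the Euclidean segments $[x,z]$ and $[y,z]$. The visual angle metric of a domain $G\subsetneq\mathbb{R}^n$ (with $\partial G$ not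 a proper subset of a line) is $v_G(x,y)=\sup\{\measuredangle(x,z,y): z\in\partial G\}$ for $x,y\in G$. A point $z\in\partial G$ at which this supremum is attained is called an extremal point for $v_G(x,y)$.
   Formalization: For n ≥ 3 the geodesic through the midpoint orthogonal to J[x,y] is not unique and the claim fails for some choices; here the bisector L_xy is required to lie in a two-dimensional linear subspace containing x and y (automatic for n = 2 or when 0, x, y are collinear). *)

(* Defs.v *)
From HB Require Import structures.
From mathcomp Require Import all_boot all_order all_algebra.
From mathcomp Require Import ring lra.
From mathcomp Require Import all_classical all_reals all_analysis.

Set Implicit Arguments.
Unset Strict Implicit.
Unset Printing Implicit Defensive.
Import Order.TTheory GRing.Theory Num.Theory.
Import numFieldNormedType.Exports.
Local Open Scope classical_set_scope.
Local Open Scope ring_scope.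

Definition dot (R : realType) (n : nat) (x y : 'rV[R]_n) : R :=
  \sum_(i < n) x 0 i * y 0 i.

(* The library norm on matrices is the sup norm, hence a separate Euclidean
   norm; the topology of 'rV[R]_n is the same for both. *)
Definition enorm (R : realType) (n : nat) (x : 'rV[R]_n) : R :=
  Num.sqrt (dot x x).

Definition uball (R : realType) (n : nat) : set 'rV[R]_n :=
  [set z | enorm z < 1].

Definition boundary (T : topologicalType) (A : set T) : set T :=
  closure A `\` interior A.

Definition angle (R : realType) (n : nat) (x z y : 'rV[R]_n) : R :=
  acos (dot (x - z) (y - z) / (enorm (x - z) * enorm (y - z))).

Definition visual_angle (R : realType) (n : nat) (G : set 'rV[R]_n)
    (x y : 'rV[R]_n) : R :=
  sup [set angle x z y | z in boundary G].

Definition extremal (R : realType) (n : nat) (G : set 'rV[R]_n)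
    (x y z : 'rV[R]_n) : Prop :=
  boundary G z /\ angle x z y = visual_angle G x y.

Definition sinh (R : realType) (t : R) : R := (expR t - expR (- t)) / 2.

Definition arsinh (R : realType) (t : R) : R :=
  ln (t + Num.sqrt (t ^+ 2 + 1)).

Definition hdist (R : realType) (n : nat) (x y : 'rV[R]_n) : R :=
  2 * arsinh (enorm (x - y) /
              Num.sqrt ((1 - enorm x ^+ 2) * (1 - enorm y ^+ 2))).

Lemma arsinhK (R : realType) : cancel (@arsinh R) (@sinh R).
Proof.
move=> t; rewrite /sinh /arsinh.
have h1 : 0 <= t ^+ 2 + 1 by rewrite addr_ge0 ?sqr_ge0.
set s := Num.sqrt _.
have s2 : s ^+ 2 = t ^+ 2 + 1 by rewrite sqr_sqrtr.
have s0 : 0 <= s by rewrite sqrtr_ge0.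
have p : 0 < t + s by nra.
rewrite expRN lnK ?posrE//.
have -> : (t + s)^-1 = s - t.
  apply: (mulfI (lt0r_neq0 p)); rewrite divff ?lt0r_neq0//.
  by rewrite -[LHS](addrK (t ^+ 2)) addrC [1 + _]addrC -s2; ring.
by field.
Qed.

Lemma sinh_hdist (R : realType) (n : nat) (x y : 'rV[R]_n) :
  sinh (hdist x y / 2) =
  enorm (x - y) / Num.sqrt ((1 - enorm x ^+ 2) * (1 - enorm y ^+ 2)).
Proof. by rewrite /hdist mulrC mulKf ?pnatr_eq0// arsinhK. Qed.

Definition diameter (R : realType) (n : nat) (e : 'rV[R]_n) : set 'rV[R]_n :=
  [set t *: e | t in [set t : R | -1 < t < 1]].

Definition circle_pt (R : realType) (n : nat) (c : 'rV[R]_n) (r : R)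
    (e1 e2 : 'rV[R]_n) (t : R) : 'rV[R]_n :=
  c + r *: (cos t *: e1 + sin t *: e2).

Definition circle_dir (R : realType) (n : nat) (e1 e2 : 'rV[R]_n) (t : R) :
    'rV[R]_n :=
  - sin t *: e1 + cos t *: e2.

Definition circle_arc (R : realType) (n : nat) (c : 'rV[R]_n) (r : R)
    (e1 e2 : 'rV[R]_n) : set 'rV[R]_n :=
  range (circle_pt c r e1 e2) `&` @uball R n.

Definition orthonormal2 (R : realType) (n : nat) (e1 e2 : 'rV[R]_n) : Prop :=
  [/\ enorm e1 = 1, enorm e2 = 1 & dot e1 e2 = 0].

(* The circle meets the unit sphere, and wherever it does, it runs along the
   normal of the sphere. *)
Definition orthogonal_circle (R : realType) (n : nat) (c : 'rV[R]_n) (r : R)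
    (e1 e2 : 'rV[R]_n) : Prop :=
  [/\ 0 < r, orthonormal2 e1 e2,
      exists t, enorm (circle_pt c r e1 e2 t) = 1
    & forall t, enorm (circle_pt c r e1 e2 t) = 1 ->
        exists k : R, circle_dir e1 e2 t = k *: circle_pt c r e1 e2 t].

Definition geodesic_line (R : realType) (n : nat) (L : set 'rV[R]_n) : Prop :=
  (exists2 e : 'rV[R]_n, enorm e = 1 & L = diameter e) \/
  (exists (c : 'rV[R]_n) (r : R) (e1 e2 : 'rV[R]_n),
     orthogonal_circle c r e1 e2 /\ L = circle_arc c r e1 e2).

(* v is a unit tangent vector at p of the geodesic line L *)
Definition geodesic_tangent (R : realType) (n : nat) (L : set 'rV[R]_n)
    (p v : 'rV[R]_n) : Prop :=
  L p /\
  ((enorm v = 1 /\ L = diameter v) \/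
   (exists (c : 'rV[R]_n) (r : R) (e1 e2 : 'rV[R]_n) (t : R),
      [/\ orthogonal_circle c r e1 e2, L = circle_arc c r e1 e2,
          p = circle_pt c r e1 e2 t & v = circle_dir e1 e2 t])).

(* The ball model is conformal, so angles between geodesic lines are the
   Euclidean angles between their tangents. *)
Definition geodesic_orthogonal (R : realType) (n : nat) (L M : set 'rV[R]_n)
    (p : 'rV[R]_n) : Prop :=
  exists v w : 'rV[R]_n,
    [/\ geodesic_tangent L p v, geodesic_tangent M p w & dot v w = 0].

Definition hsegment (R : realType) (n : nat) (x y : 'rV[R]_n) :
    set 'rV[R]_n :=
  [set z | exists M : set 'rV[R]_n,
     [/\ geodesic_line M, M x, M y, M z & hdist x z + hdist z y = hdist x y]].

Definition hmidpoint (R : realType) (n : nat) (x y m : 'rV[R]_n) : Prop :=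
  hsegment x y m /\ hdist x m = hdist m y.

(* For n >= 3 there are many geodesic lines through the midpoint orthogonal to
   the segment; the bisector is the one in a plane through 0, x and y (the row
   space of P). For n = 2 this last clause always holds; if 0, x, y are
   collinear, it holds for every geodesic line satisfying the other clauses. *)
Definition hbisector (R : realType) (n : nat) (x y : 'rV[R]_n)
    (L : set 'rV[R]_n) : Prop :=
  [/\ geodesic_line L,
      exists (M : set 'rV[R]_n) (m : 'rV[R]_n),
        [/\ geodesic_line M, M x, M y, hmidpoint x y m
          & geodesic_orthogonal L M m]
    & exists P : 'M[R]_(2, n),
        [/\ (x <= P)%MS, (y <= P)%MS & forall z, L z -> (z <= P)%MS]].

Definition geodesic_endpoints (R : realType) (n : nat) (L : set 'rV[R]_n)
    (u w : 'rV[R]_n) : Prop :=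
  u <> w /\ closure L `&` boundary (@uball R n) = [set u; w].

(* Main.v *)
Require Import Defs.
From HB Require Import structures.
From mathcomp Require Import all_boot all_order all_algebra.
From mathcomp Require Import ring lra.
From mathcomp Require Import all_classical all_reals all_analysis.

Set Implicit Arguments.
Unset Strict Implicit.
Unset Printing Implicit Defensive.
Import Order.TTheory GRing.Theory Num.Theory.
Import numFieldNormedType.Exports.
Local Open Scope classical_set_scope.
Local Open Scope ring_scope.

(* With a = 1 - |x|^2 and b = 1 - |y|^2, the points at equal hyperbolic distance
   from x and y satisfy (b - a) (1 + |z|^2) = 2 (b x - a y) . z.  The gradient of
   this equation at the hyperbolic midpoint is tangent to the geodesic through x
   and y, so the bisector L is tangent to, hence contained in, this sphere or
   hyperplane, and its endpoints satisfy (b x - a y) . z = b - a.  For a unit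
   vector u, this says that the spheres through x and through y internally
   tangent to the unit sphere at u coincide.  The two endpoints are separated by
   the line xy in the plane of 0, x, y; let u be the one on the side away from 0.
   Rotating a boundary point z about the line xy into that side of the plane does
   not decrease its norm, so the rotated point is outside the tangent sphere at u
   and sees the segment [x, y] under an angle at most that at u. *)

(** * Real inequalities in plane coordinates *)

(** Both quotients are cosines, of angles with cotangents [B / (sqrt D * b)] and [A / (sqrt D * a)],
    and the cosine increases with the cotangent. The cotangents are compared by
    cross-multiplication, which allows [a = 0]. *)
Lemma ler_div_hypot (R : rcfType) (D A B a b : R) :
  0 <= D -> 0 <= a -> 0 < b -> B * a <= A * b ->
  0 < A ^+ 2 + D * a ^+ 2 -> 0 < B ^+ 2 + D * b ^+ 2 ->
  B / Num.sqrt (B ^+ 2 + D * b ^+ 2) <= A / Num.sqrt (A ^+ 2 + D * a ^+ 2).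
Proof.
move=> D0 a0 b0 le pA pB.
have SA := sqr_sqrtr (ltW pA); have SB := sqr_sqrtr (ltW pB).
have A0 : 0 < Num.sqrt (A ^+ 2 + D * a ^+ 2) by rewrite sqrtr_gt0.
have B0 : 0 < Num.sqrt (B ^+ 2 + D * b ^+ 2) by rewrite sqrtr_gt0.
move: (Num.sqrt _) (Num.sqrt _) SA SB A0 B0 => S T SA SB S0 T0.
rewrite ler_pdivrMr // mulrAC ler_pdivlMr //.
have [A0|A0] := leP 0 A.
  have [B0|B0] := leP B 0.
    by apply: (@le_trans _ _ 0); [rewrite mulr_le0_ge0 // ltW | rewrite mulr_ge0 // ltW].
  have h : (B * a) ^+ 2 <= (A * b) ^+ 2.
    by rewrite ler_sqr ?nnegrE // mulr_ge0 // ltW.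
  rewrite -ler_sqr ?nnegrE ?mulr_ge0 ?(ltW S0) ?(ltW T0) ?(ltW B0) //.
  rewrite !exprMn SA SB !mulrDr !(mulrC (_ ^+ 2) (D * _)) [A ^+ 2 * _]mulrC lerD2l.
  by rewrite -!mulrA ler_wpM2l //; move: h; rewrite !exprMn; lra.
have Ab : A * b < 0 by rewrite pmulr_llt0.
have B0 : B < 0 by rewrite ltNge; apply/negP => B0; have := mulr_ge0 B0 a0; lra.
have h : (- A * b) ^+ 2 <= (- B * a) ^+ 2.
  by rewrite ler_sqr ?nnegrE; [lra | nra | nra].
rewrite -lerN2 -!mulNr -ler_sqr ?nnegrE; [|nra..].
rewrite !exprMn SA SB !sqrrN !mulrDr [A ^+ 2 * _]mulrC lerD2l.
by rewrite !(mulrCA _ D) ler_wpM2l //; move: h; rewrite !exprMn !sqrrN; lra.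
Qed.

(* [k u] is the centre of the sphere through [x] and [y] that is internally
   tangent to the unit sphere at [u]; its power at [z], rotated about the line
   [x y] to the point [(al, nu + be)], is nonnegative. *)
Lemma tangent_circle_le (R : realFieldType) (xi eta nu s t al be : R) :
  let a := 1 - xi ^+ 2 - nu ^+ 2 in
  let b := 1 - eta ^+ 2 - nu ^+ 2 in
  xi != eta -> 0 < a -> 0 < b -> s ^+ 2 + t ^+ 2 = 1 ->
  (b * xi - a * eta) * s + (b - a) * nu * t = b - a ->
  nu < t -> 0 <= be -> 1 <= al ^+ 2 + (nu + be) ^+ 2 ->
  ((xi - s) * (eta - s) + (t - nu) ^+ 2) * be <=
  ((xi - al) * (eta - al) + be ^+ 2) * (t - nu).
Proof.
move=> a b neq a0 b0 st orth tnu be0 z1.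
pose p := xi * s + nu * t.
(* The difference of the two sides is [|x - u|^2]. *)
have ap : a < 2 - 2 * p.
  have := sqr_ge0 (xi - s); have : 0 < (t - nu) ^+ 2 by rewrite exprn_gt0 // subr_gt0.
  rewrite /a /p; nra.
have P0 : 0 < 2 - 2 * p by lra.
(* Tangency at [u] makes the radius [1 - k]; [|x - k u| = 1 - k] then reads [k * (2 - 2 * p) = a].
   By [orth] the same [k] serves [y]. *)
pose k := a / (2 - 2 * p).
have k0 : 0 < k by rewrite divr_gt0.
have k1 : k < 1 by rewrite ltr_pdivrMr // mul1r.
have kx : k * (2 - 2 * p) = a by rewrite divfK // lt0r_neq0.
have ky : k * (2 - 2 * (eta * s + nu * t)) = b.
  apply: (mulIf (lt0r_neq0 P0)); rewrite mulrAC kx.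
  by move: orth; rewrite /p; lra.
have ks : 2 * k * s = xi + eta.
  have /mulfI : xi - eta != 0 by rewrite subr_eq0.
  apply; move: kx ky; rewrite /a /b /p => kx ky.
  have -> : (xi - eta) * (xi + eta) = (1 - eta ^+ 2 - nu ^+ 2) - (1 - xi ^+ 2 - nu ^+ 2) by ring.
  by rewrite -kx -ky; ring.
have xe : xi * eta = 2 * k - 2 * nu * k * t - 1 + nu ^+ 2.
  have -> : eta = 2 * k * s - xi by rewrite ks; ring.
  by move: kx; rewrite /a /p; lra.
(* The power of [u] is zero, so this is the equality case of [eZ], at [be = t - nu]. *)
have eU : (xi - s) * (eta - s) + (t - nu) ^+ 2 = 2 * (t - nu) * (k * t - nu).
  have -> : (xi - s) * (eta - s) = xi * eta - (xi + eta) * s + s ^+ 2 by ring.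
  rewrite xe -ks; have -> : 2 * k * s * s = 2 * k * (1 - t ^+ 2) by rewrite -st; ring.
  have -> : s ^+ 2 = 1 - t ^+ 2 by rewrite -st; ring.
  by ring.
(* With [Z = (al, nu + be)], the power of [Z] is [k * |Z - u|^2 + (1 - k) * (|Z|^2 - 1)], a sum of
   nonnegative terms. *)
have eZ : 2 * be * (k * t - nu) <= (xi - al) * (eta - al) + be ^+ 2.
  have -> : (xi - al) * (eta - al) = xi * eta - (xi + eta) * al + al ^+ 2 by ring.
  rewrite xe -ks.
  have h : 2 * (al * s + (nu + be) * t) <= al ^+ 2 + (nu + be) ^+ 2 + 1.
    by have := sqr_ge0 (al - s); have := sqr_ge0 (nu + be - t); rewrite -st; nra.
  have := ler_wpM2l (ltW k0) h.
  have : 0 <= (1 - k) * (al ^+ 2 + (nu + be) ^+ 2 - 1) by rewrite mulr_ge0 // subr_ge0 // ltW.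
  by nra.
rewrite eU; have -> : 2 * (t - nu) * (k * t - nu) * be = 2 * be * (k * t - nu) * (t - nu) by ring.
by rewrite ler_wpM2r // subr_ge0 ltW.
Qed.

(** Eliminating the first coordinate makes [t] and [t'] the roots of a quadratic with positive
    leading coefficient; by Vieta the claim is that its value at [nu] is negative. *)
Lemma endpoints_separated (R : realFieldType) (xi eta nu s t s' t' : R) :
  let a := 1 - xi ^+ 2 - nu ^+ 2 in
  let b := 1 - eta ^+ 2 - nu ^+ 2 in
  xi != eta -> 0 < a -> 0 < b ->
  s ^+ 2 + t ^+ 2 = 1 -> s' ^+ 2 + t' ^+ 2 = 1 ->
  (b * xi - a * eta) * s + (b - a) * nu * t = b - a ->
  (b * xi - a * eta) * s' + (b - a) * nu * t' = b - a ->
  (s, t) <> (s', t') -> (t - nu) * (t' - nu) < 0.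
Proof.
move=> a b neq a0 b0 st st' orth orth' d.
set k := b * xi - a * eta in orth orth'.
have c0 : 0 < 1 - nu ^+ 2 by move: a0; rewrite /a; have := sqr_ge0 xi; lra.
(* Equivalently, the line of [orth] meets the line at height [nu] inside the unit disc: there
   [k * s = (b - a) * (1 - nu ^+ 2)], and this gives [s ^+ 2 < 1 - nu ^+ 2]. *)
have kd : 0 < k ^+ 2 - (b - a) ^+ 2 * (1 - nu ^+ 2).
  have -> : k ^+ 2 - (b - a) ^+ 2 * (1 - nu ^+ 2) = (xi - eta) ^+ 2 * (a * b).
    by rewrite /k /a /b; ring.
  by rewrite mulr_gt0 ?exprn_even_gt0 ?subr_eq0 // mulr_gt0.
move: (b - a) kd orth orth' => f kd orth orth'.
have k2 : 0 < k ^+ 2.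
  by have : 0 <= f ^+ 2 * (1 - nu ^+ 2) by [rewrite mulr_ge0 ?sqr_ge0 ?(ltW c0)]; lra.
have k0 : k != 0 by rewrite -sqrf_eq0 lt0r_neq0.
have l0 : 0 < k ^+ 2 + f ^+ 2 * nu ^+ 2.
  by have : 0 <= f ^+ 2 * nu ^+ 2 by [rewrite mulr_ge0 ?sqr_ge0]; lra.
have quad r r' : r ^+ 2 + r' ^+ 2 = 1 -> k * r + f * nu * r' = f ->
    (k ^+ 2 + f ^+ 2 * nu ^+ 2) * r' ^+ 2 - 2 * f ^+ 2 * nu * r' + f ^+ 2 - k ^+ 2 = 0.
  move=> h1 h2; have e : k * r = f - f * nu * r' by lra.
  have : (k * r) ^+ 2 = k ^+ 2 * (1 - r' ^+ 2) by rewrite -h1; ring.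
  by rewrite e => h; lra.
have q1 := quad _ _ st orth; have q2 := quad _ _ st' orth'.
have tt : t != t'.
  apply/eqP => e; apply: d; rewrite -e; congr pair; apply: (mulfI k0).
  by rewrite -e in orth'; lra.
have sum : (k ^+ 2 + f ^+ 2 * nu ^+ 2) * (t + t') = 2 * f ^+ 2 * nu.
  have /mulfI : t - t' != 0 by rewrite subr_eq0.
  by apply; lra.
have prod : (k ^+ 2 + f ^+ 2 * nu ^+ 2) * (t * t') = f ^+ 2 - k ^+ 2.
  have -> : t' = (t + t') - t by ring.
  rewrite !mulrBr mulrCA sum; lra.
rewrite -(pmulr_rlt0 _ l0).
have -> : (k ^+ 2 + f ^+ 2 * nu ^+ 2) * ((t - nu) * (t' - nu)) =
  (k ^+ 2 + f ^+ 2 * nu ^+ 2) * (t * t') - nu * ((k ^+ 2 + f ^+ 2 * nu ^+ 2) * (t + t'))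
   + (k ^+ 2 + f ^+ 2 * nu ^+ 2) * nu ^+ 2 by ring.
rewrite sum prod.
have := mulr_gt0 c0 kd; lra.
Qed.

(** * The Euclidean inner product, closures and the unit sphere *)

Section Dot.
Context (R : realType) (n : nat).
Implicit Types x y z : 'rV[R]_n.

Lemma dotC x y : dot x y = dot y x.
Proof. by apply: eq_bigr => i _; rewrite mulrC. Qed.

Lemma dotDl x y z : dot (x + y) z = dot x z + dot y z.
Proof. by rewrite -big_split; apply: eq_bigr => i _; rewrite mxE mulrDl. Qed.

Lemma dotZl k x y : dot (k *: x) y = k * dot x y.
Proof. by rewrite mulr_sumr; apply: eq_bigr => i _; rewrite mxE mulrA. Qed.

Lemma dotNl x y : dot (- x) y = - dot x y.
Proof. by rewrite -scaleN1r dotZl mulN1r. Qed.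

Lemma dotDr x y z : dot z (x + y) = dot z x + dot z y.
Proof. by rewrite !(dotC z) dotDl. Qed.

Lemma dotZr k x y : dot y (k *: x) = k * dot y x.
Proof. by rewrite !(dotC y) dotZl. Qed.

Lemma dotNr x y : dot y (- x) = - dot y x.
Proof. by rewrite !(dotC y) dotNl. Qed.

Definition dotE := (dotDl, dotDr, dotNl, dotNr, dotZl, dotZr).

Lemma dot_ge0 x : 0 <= dot x x.
Proof. by apply: sumr_ge0 => i _; rewrite -expr2 sqr_ge0. Qed.

Lemma dot_eq0 x : (dot x x == 0) = (x == 0).
Proof.
apply/eqP/eqP => [h|->]; last by rewrite /dot big1 // => i _; rewrite mxE mul0r.
apply/rowP => i; rewrite mxE; apply/eqP; rewrite -sqrf_eq0 expr2.
by rewrite (psumr_eq0P _ h) // => j _; rewrite -expr2 sqr_ge0.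
Qed.

Lemma enorm_sq x : enorm x ^+ 2 = dot x x.
Proof. by rewrite sqr_sqrtr // dot_ge0. Qed.

Lemma enorm_eq1 x : enorm x = 1 <-> dot x x = 1.
Proof. by rewrite -enorm_sq; split=> [->|/eqP]; rewrite ?expr1n // sqrf_eq1 =>
  /orP[/eqP //|/eqP h]; have := sqrtr_ge0 (dot x x); rewrite -/(enorm x) h oppr_ge0 ler10. Qed.

Lemma uballE x : uball x <-> dot x x < 1.
Proof.
by rewrite /uball /= /enorm -[X in _ < X]sqrtr1 ltr_sqrt.
Qed.

Lemma dot_continuous y : continuous (fun z => dot y z).
Proof.
apply: (@continuous_big R^o 'I_n +%R 0 xpredT (@add_continuous R^o) _ _
  (fun i (z : 'rV[R]_n) => y 0 i * z 0 i)) => i _ z.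
have := @continuousM R _ (fun=> y 0 i) (fun z : 'rV[R]_n => z 0 i) z.
by apply; [exact: cst_continuous | exact: coord_continuous].
Qed.

Lemma sqnorm_continuous : continuous (fun z : 'rV[R]_n => dot z z).
Proof.
apply: (@continuous_big R^o 'I_n +%R 0 xpredT (@add_continuous R^o) _ _
  (fun i (z : 'rV[R]_n) => z 0 i * z 0 i)) => i _ z.
have := @continuousM R _ (fun z : 'rV[R]_n => z 0 i) (fun z : 'rV[R]_n => z 0 i) z.
by apply; exact: coord_continuous.
Qed.

Lemma closure_zeros (f : 'rV[R]_n -> R) (A : set 'rV[R]_n) :
  continuous f -> (forall z, A z -> f z = 0) ->
  forall z, closure A z -> f z = 0.
Proof.
move=> fc fA z Az.
have cl : closed [set t | f t = 0].
  by apply: (@preimage_closed _ _ f [set 0]); [move=> ? _; exact: fc | exact: closed_eq].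
suff : [set t | f t = 0] z by [].
by rewrite (proj1 (closure_id _) cl); exact: closure_subset fA _ Az.
Qed.

(** A row space is cut out by linear equations, the columns of its cokernel, hence is closed. This
    puts the endpoints of the bisector in the plane of [P]. *)
Lemma closure_submx (m : nat) (P : 'M[R]_(m, n)) (A : set 'rV[R]_n) :
  (forall z, A z -> (z <= P)%MS) -> forall z, closure A z -> (z <= P)%MS.
Proof.
move=> AP z Az; rewrite submxE; apply/eqP/rowP => j; rewrite !mxE.
have e (t : 'rV[R]_n) : \sum_k t 0 k * cokermx P k j = dot (col j (cokermx P))^T t.
  by apply: eq_bigr => k _; rewrite !mxE mulrC.
rewrite e; apply: (closure_zeros (@dot_continuous _) _ Az) => t /AP.
by rewrite submxE -e => /eqP/rowP/(_ j); rewrite !mxE.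
Qed.

Lemma boundary_uball z : boundary (@uball R n) z -> dot z z = 1.
Proof.
have uE : @uball R n = (fun t => dot t t) @^-1` [set r | r < 1].
  by apply/seteqP; split=> t /uballE.
have op : open (@uball R n).
  by rewrite uE; apply: open_comp => [? _|]; [exact: sqnorm_continuous | exact: open_lt].
case; rewrite (proj1 (interior_id _) op) => cz nz; apply/eqP; rewrite eq_le; apply/andP; split.
  have cl : closed [set t : 'rV[R]_n | dot t t <= 1].
    by apply: (@preimage_closed _ _ (fun t : 'rV[R]_n => dot t t) [set r | r <= 1]);
      [move=> ? _; exact: sqnorm_continuous | exact: closed_le].
  have sub : @uball R n `<=` [set t | dot t t <= 1] by move=> t /uballE /ltW.
  suff : [set t : 'rV[R]_n | dot t t <= 1] z by [].
  by rewrite (proj1 (closure_id _) cl); exact: closure_subset sub _ cz.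
by rewrite leNgt; apply/negP => h; apply: nz; apply/uballE.
Qed.

End Dot.

(** * Angles over the segment in an orthonormal frame *)

Section Plane.
Context (R : realType) (n : nat).
Implicit Types x y z u w v e N : 'rV[R]_n.

Lemma acos_le (s t : R) : -1 <= s <= 1 -> -1 <= t <= 1 -> s <= t ->
  acos t <= acos s.
Proof.
move=> s1 t1 st; rewrite leNgt; apply/negP => h.
have := @ltr_cos R (acos s) (acos t).
rewrite !in_itv /= !acos_ge0 ?acos_lepi // => /(_ isT isT).
by rewrite h !acosK ?in_itv //= ltNge st.
Qed.

Lemma hypot_ratio_bound (D A b : R) : 0 <= D -> 0 < A ^+ 2 + D * b ^+ 2 ->
  -1 <= A / Num.sqrt (A ^+ 2 + D * b ^+ 2) <= 1.
Proof.
move=> D0 p; rewrite -ler_norml normrM normfV (ger0_norm (sqrtr_ge0 _)).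
rewrite ler_pdivrMr ?sqrtr_gt0 // mul1r -sqrtr_sqr ler_sqrt; last exact: ltW.
by rewrite lerDl mulr_ge0 ?sqr_ge0.
Qed.

(* [be] is the distance from [z] to the line [x y], so the square root is
   [|x - z| |y - z|] by Lagrange's identity. *)
Lemma angle_coords e N z (xi eta nu be : R) :
  dot e e = 1 -> dot N N = 1 -> dot e N = 0 ->
  be ^+ 2 = dot z z - dot z e ^+ 2 - 2 * nu * dot z N + nu ^+ 2 ->
  let A := (xi - dot z e) * (eta - dot z e) + be ^+ 2 in
  angle (xi *: e + nu *: N) z (eta *: e + nu *: N) =
  acos (A / Num.sqrt (A ^+ 2 + (xi - eta) ^+ 2 * be ^+ 2)).
Proof.
move=> ee NN eN be2 A; have Ne : dot N e = 0 by rewrite dotC.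
rewrite /angle /enorm -sqrtrM ?dot_ge0 //.
have dE (r s : R) : dot (r *: e + nu *: N - z) (s *: e + nu *: N - z) =
    (r - dot z e) * (s - dot z e) + be ^+ 2.
  by rewrite be2 !dotE !(dotC _ z) ee NN eN Ne; ring.
by rewrite !dE; congr (acos (_ / Num.sqrt _)); rewrite /A; ring.
Qed.

(** [e] directs the line through [x] and [y], and [N] points away from the origin since [0 <= nu].
    The angle at [z] depends only on [dot z e] and the distance to this line, so [z] can be moved
    into the plane, on the side of [u], and [tangent_circle_le] compares cotangents. *)
Lemma angle_le_endpoint e N u z (xi eta nu : R) :
  dot e e = 1 -> dot N N = 1 -> dot e N = 0 ->
  let x := xi *: e + nu *: N in
  let y := eta *: e + nu *: N in
  let a := 1 - dot x x in
  let b := 1 - dot y y in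
  xi != eta -> 0 < a -> 0 < b -> 0 <= nu ->
  u = dot u e *: e + dot u N *: N -> nu < dot u N -> dot u u = 1 ->
  dot (b *: x - a *: y) u = b - a -> dot z z = 1 ->
  angle x z y <= angle x u y.
Proof.
move=> ee NN eN x y a b neq a0 b0 nu0 uE nut uu qu zz.
have Ne : dot N e = 0 by rewrite dotC.
have aE : a = 1 - xi ^+ 2 - nu ^+ 2.
  by rewrite /a /x !dotE ee NN eN Ne; ring.
have bE : b = 1 - eta ^+ 2 - nu ^+ 2.
  by rewrite /b /y !dotE ee NN eN Ne; ring.
have st : dot u e ^+ 2 + dot u N ^+ 2 = 1.
  by rewrite -uu {3 4}uE !dotE ee NN eN Ne; ring.
have orth : (b * xi - a * eta) * dot u e + (b - a) * nu * dot u N = b - a.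
  by rewrite -[RHS]qu /x /y !dotE !(dotC _ u); ring.
pose be2 := dot z z - dot z e ^+ 2 - 2 * nu * dot z N + nu ^+ 2.
have be2E : be2 = (dot z N - nu) ^+ 2 +
    dot (z - dot z e *: e - dot z N *: N) (z - dot z e *: e - dot z N *: N).
  by rewrite /be2 !dotE !(dotC _ z) ee NN eN Ne; ring.
have le_be2 : (dot z N - nu) ^+ 2 <= be2 by rewrite be2E lerDl dot_ge0.
have be20 : 0 <= be2 by apply: le_trans le_be2; exact: sqr_ge0.
pose be := Num.sqrt be2.
have beE : be ^+ 2 = be2 by rewrite sqr_sqrtr.
have be0 : 0 <= be by rewrite sqrtr_ge0.
have le_be : dot z N - nu <= be.
  by apply: le_trans (ler_norm _) _; rewrite -sqrtr_sqr ler_sqrt.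
(* The right side equals [1 + 2 * nu * (be - (dot z N - nu))]. *)
have z1 : 1 <= dot z e ^+ 2 + (nu + be) ^+ 2.
  have := ler_wpM2l nu0 le_be; move: beE; rewrite /be2 zz => beE h.
  by have -> : (nu + be) ^+ 2 = nu ^+ 2 + 2 * nu * be + be ^+ 2 by [ring]; lra.
have D0 := sqr_ge0 (xi - eta).
have tb : (dot u N - nu) ^+ 2 = dot u u - dot u e ^+ 2 - 2 * nu * dot u N + nu ^+ 2.
  by rewrite uu; lra.
have bu0 : 0 < dot u N - nu by rewrite subr_gt0.
rewrite (angle_coords _ _ ee NN eN beE) (angle_coords _ _ ee NN eN tb).
(* Lagrange's identity: the two sides are equal, so the denominators vanish only if the vertex is
   [x] or [y]. *)
have pos (s c : R) (h : 0 < ((xi - s) ^+ 2 + c ^+ 2) * ((eta - s) ^+ 2 + c ^+ 2)) :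
    0 < ((xi - s) * (eta - s) + c ^+ 2) ^+ 2 + (xi - eta) ^+ 2 * c ^+ 2.
  by apply: lt_le_trans h _; rewrite le_eqVlt; apply/orP; left; apply/eqP; ring.
have posZ (r : R) : 0 < 1 - r ^+ 2 - nu ^+ 2 -> 0 < (r - dot z e) ^+ 2 + be ^+ 2.
  move=> h; rewrite lt_neqAle addr_ge0 ?sqr_ge0 // andbT eq_sym.
  apply/eqP => /eqP; rewrite paddr_eq0 ?sqr_ge0 // !sqrf_eq0 subr_eq0 => /andP[/eqP rE /eqP b0'].
  by move: z1; rewrite b0' -rE addr0; lra.
have posU (r : R) : 0 < (r - dot u e) ^+ 2 + (dot u N - nu) ^+ 2.
  by rewrite ltr_wpDl ?sqr_ge0 // exprn_gt0.
rewrite aE in a0; rewrite bE in b0.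
have pZ := pos _ _ (mulr_gt0 (posZ _ a0) (posZ _ b0)).
have pU := pos _ _ (mulr_gt0 (posU xi) (posU eta)).
apply: acos_le; rewrite ?hypot_ratio_bound //.
apply: ler_div_hypot => //.
by apply: tangent_circle_le => //; rewrite -aE -bE.
Qed.

(** Gram-Schmidt on [e] and [v] gives two orthonormal rows in the row space of [P]; since [P] has
    rank at most two, they span it. *)
Lemma plane_frame (P : 'M[R]_(2, n)) e v : dot e e = 1 ->
  (e <= P)%MS -> (v <= P)%MS -> v != dot v e *: e ->
  exists N, [/\ dot N N = 1, dot e N = 0 &
    forall z, (z <= P)%MS -> z = dot z e *: e + dot z N *: N].
Proof.
move=> ee eP vP ve; pose p := v - dot v e *: e.
have p0 : 0 < dot p p by rewrite lt_neqAle dot_ge0 eq_sym dot_eq0 subr_eq0 ve.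
pose N := (enorm p)^-1 *: p.
have NN : dot N N = 1.
  by rewrite /N dotZl dotZr mulrA -invfM -expr2 enorm_sq mulVf // lt0r_neq0.
have eN : dot e N = 0 by rewrite /N /p !dotE ee (dotC e); ring.
exists N; split=> // z zP.
pose A : 'M[R]_(1 + 1, n) := col_mx e N.
have AP : (A <= P)%MS.
  by rewrite col_mx_sub eP scalemx_sub // addmx_sub ?eqmx_opp ?scalemx_sub.
have mulT (s t : 'rV[R]_n) : s *m t^T = (dot s t)%:M.
  by apply/matrixP => i j; rewrite !mxE !ord1 mulr1n; apply: eq_bigr => k _; rewrite mxE.
have AA : A *m A^T = 1%:M.
  rewrite tr_col_mx mul_col_row !mulT ee NN eN dotC eN.
  have -> : 0%:M = 0 :> 'M[R]_1 by rewrite -scalemx1 scale0r.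
  by rewrite -scalar_mx_block.
have fA : row_free A by apply/row_freeP; exists A^T.
have : (z <= A)%MS.
  apply: submx_trans zP _; rewrite -(geq_leqif (mxrank_leqif_sup AP)).
  by rewrite (eqP fA) rank_leq_row.
case/submxP => D zE.
have DE : D = z *m A^T by rewrite zE -mulmxA AA mulmx1.
by rewrite [LHS]zE DE tr_col_mx mul_mx_row mul_row_col !mulT !mul_scalar_mx.
Qed.

End Plane.

(** * The equation of the bisector and of its endpoints *)

Section Bisector.
Context (R : realType) (n : nat).
Implicit Types x y z m u w v q c : 'rV[R]_n.

Lemma dot_span (e1 e2 : 'rV[R]_n) z (s t : R) v : orthonormal2 e1 e2 ->
  z = s *: e1 + t *: e2 -> dot v z = dot v e1 * dot z e1 + dot v e2 * dot z e2.
Proof.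
case=> /enorm_eq1 h1 /enorm_eq1 h2 h ->.
by rewrite !dotE h1 h2 h (dotC e2) h; ring.
Qed.

(* At a common point of the circle and the unit sphere the tangent is
   [k *: p] with [k ^+ 2 = 1]; hence the centre is [+- tangent - r *: normal]. *)
Lemma orthogonal_circle_center c (r : R) (e1 e2 : 'rV[R]_n) : orthogonal_circle c r e1 e2 ->
  dot c c = 1 + r ^+ 2 /\ exists s t : R, c = s *: e1 + t *: e2.
Proof.
case=> r0 [/enorm_eq1 h1 /enorm_eq1 h2 h] [t0 t1] /(_ _ t1) [k kE].
have h' : dot e2 e1 = 0 by rewrite dotC.
move/enorm_eq1: t1; have := cos2Dsin2 t0; move: kE.
rewrite /circle_dir /circle_pt; move: (cos t0) (sin t0) => C S kE CS pp.
have dd : k ^+ 2 = 1.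
  have : dot (- S *: e1 + C *: e2) (- S *: e1 + C *: e2) = 1.
    by rewrite -CS !dotE h1 h2 h h'; ring.
  by rewrite kE dotZl dotZr pp mulr1.
have cE : c = (- k * S - r * C) *: e1 + (k * C - r * S) *: e2.
  have : k *: (c + r *: (C *: e1 + S *: e2)) = - S *: e1 + C *: e2 by rewrite kE.
  move/(congr1 (fun v => k *: v)); rewrite scalerA -expr2 dd scale1r => h3.
  rewrite -[LHS](addrK (r *: (C *: e1 + S *: e2))) h3.
  by apply/rowP => i; rewrite !mxE; ring.
split; last by exists (- k * S - r * C), (k * C - r * S).
rewrite cE !dotE h1 h2 h h'.
transitivity ((k ^+ 2 + r ^+ 2) * (C ^+ 2 + S ^+ 2)); first by ring.
by rewrite dd CS; ring.
Qed.

(** This is [|p - c|^2 = r^2] with [|c|^2 = 1 + r^2] substituted. It replaces [1 + |p|^2] by a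
    linear form on the circle. *)
Lemma orthogonal_circle_pt c r e1 e2 t : orthogonal_circle c r e1 e2 ->
  1 + dot (circle_pt c r e1 e2 t) (circle_pt c r e1 e2 t) =
  2 * dot c (circle_pt c r e1 e2 t).
Proof.
move=> oc; have [cc _] := orthogonal_circle_center oc.
case: oc => r0 [/enorm_eq1 h1 /enorm_eq1 h2 h] _ _.
rewrite /circle_pt !dotE !(dotC _ c) cc h1 h2 h (dotC e2) h.
have -> : r ^+ 2 = r ^+ 2 * (cos t ^+ 2 + sin t ^+ 2) by rewrite cos2Dsin2 mulr1.
by ring.
Qed.

Lemma circle_pt_span c (r : R) (e1 e2 : 'rV[R]_n) t : orthogonal_circle c r e1 e2 ->
  exists s s' : R, circle_pt c r e1 e2 t = s *: e1 + s' *: e2.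
Proof.
move/orthogonal_circle_center => [_ [s [s' ->]]].
exists (s + r * cos t), (s' + r * sin t).
by apply/rowP => i; rewrite !mxE; ring.
Qed.

(* [(b - a) *: m - q] is the gradient at [m] of the function vanishing on the set of
   points equidistant from [x] and [y]. *)
Lemma gradient_along_geodesic (M : set 'rV[R]_n) x y m v v' :
  let a := 1 - dot x x in
  let b := 1 - dot y y in
  let q := b *: x - a *: y in
  M x -> M y -> geodesic_tangent M m v' ->
  (b - a) * (1 + dot m m) = 2 * dot q m -> dot v v' = 0 -> dot v ((b - a) *: m - q) = 0.
Proof.
move=> a b q Mx My [Mm hM] mB vv'.
case: hM => [[_ ME]|[c [r [e1 [e2 [t [ oc ME mE vE]]]]]]].
  move: Mx My Mm; rewrite ME /q => -[s _ <-] [s' _ <-] [s'' _ <-].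
  by rewrite !dotE vv'; ring.
have [cc [c1 [c2 cE]]] := orthogonal_circle_center oc.
have [r0 on _ _] := oc.
have ptM z : M z -> 1 + dot z z = 2 * dot c z /\ exists s s' : R, z = s *: e1 + s' *: e2.
  by rewrite ME => -[[t' _ <-] _]; split; [exact: orthogonal_circle_pt | exact: circle_pt_span].
have [xc [x1 [x2 xE]]] := ptM _ Mx.
have [yc [y1 [y2 yE]]] := ptM _ My.
have [mc [m1 [m2 mE']]] := ptM _ Mm.
set G := _ - q.
have GE : G = ((b - a) * m1 - (b * x1 - a * y1)) *: e1
            + ((b - a) * m2 - (b * x2 - a * y2)) *: e2.
  by rewrite /G /q {1}mE' {1}xE {1}yE; apply/rowP => i; rewrite !mxE; ring.
(* [G] lies in the plane of the circle; orthogonal to the radius at [m], it is parallel to the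
   tangent [v'], hence orthogonal to [v]. *)
have Gn : dot (m - c) G = 0.
  have cq : dot c q = b - a.
    by rewrite /q !dotE; move: xc yc; rewrite /a /b; nra.
  by rewrite /G dotDr dotNr dotZr !dotDl !dotNl cq (dotC m q); move: mB mc; nra.
have nE : m - c = r *: (cos t *: e1 + sin t *: e2) by rewrite mE /circle_pt addrC addKr.
move: Gn; rewrite nE dotZl => /eqP; rewrite mulf_eq0 (gt_eqF r0) /= => /eqP Gn.
rewrite (dot_span v on GE); clearbody G.
move: vv' Gn; rewrite vE /circle_dir !dotE !(dotC _ G).
move: (dot v e1) (dot v e2) (dot G e1) (dot G e2) => p1 p2 g1 g2 h1 h2.
transitivity ((cos t ^+ 2 + sin t ^+ 2) * (p1 * g1 + p2 * g2)).
  by rewrite cos2Dsin2 mul1r.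
transitivity ((cos t * p1 + sin t * p2) * (cos t * g1 + sin t * g2) +
   (- sin t * p1 + cos t * p2) * (- sin t * g1 + cos t * g2)); first by ring.
by rewrite h1 h2; ring.
Qed.

(** On a circle [L] with centre [c] the equation becomes linear, [dot h z = 0] with
    [h = d *: c - q]. It holds at [m] and at the tangent [v], which span the plane of [L] because
    [m] is interior to the ball. *)
Lemma geodesic_sub_bisector (L : set 'rV[R]_n) m v q (d : R) :
  uball m -> geodesic_tangent L m v ->
  d * (1 + dot m m) = 2 * dot q m ->
  dot v (d *: m - q) = 0 ->
  forall z, L z -> d * (1 + dot z z) = 2 * dot q z.
Proof.
move=> /uballE m1 [Lm hL] mB vG z Lz.
move: vG; rewrite dotDr dotNr dotZr => /eqP; rewrite subr_eq0 => /eqP vG.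
case: hL => [[/enorm_eq1 vv LE]|[c [r [e1 [e2 [t [ oc LE mE vE]]]]]]].
  move: Lm Lz; rewrite LE => -[s s1 sE] [s' _ <-].
  move: vG mB m1; rewrite -sE !dotE vv (dotC v q) => vG mB m1.
  (* On a diameter, the equations for the value and the derivative at [m = s *: v] force [d = 0],
     then [dot q v = 0]. *)
  have : d * (1 - s * (s * 1)) = 0 by have := congr1 (fun r => s * r) vG; move: mB => /=; lra.
  move/eqP; rewrite mulf_eq0 subr_eq0 (gt_eqF m1) orbF => /eqP d0.
  by move: vG; rewrite d0 mul0r => <-; ring.
have [cc [c1 [c2 cE]]] := orthogonal_circle_center oc.
have [r0 on _ _] := oc.
pose h := d *: c - q.
have hE s : dot h s = d * dot c s - dot q s by rewrite /h !dotE.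
clearbody h.
have [z1 [z2 zE]] : exists s s' : R, z = s *: e1 + s' *: e2.
  by move: Lz; rewrite LE => -[[t' _ <-] _]; exact: circle_pt_span.
have zc : 1 + dot z z = 2 * dot c z.
  by move: Lz; rewrite LE => -[[t' _ <-] _]; exact: orthogonal_circle_pt.
have [k1 [k2 mE']] := circle_pt_span t oc; rewrite -mE in mE'.
have mc := orthogonal_circle_pt t oc; rewrite -mE in mc.
suff : dot h z = 0 by rewrite hE zc; lra.
have hm : dot h m = 0 by rewrite hE; move: mB; rewrite mc; lra.
have [/enorm_eq1 n1 /enorm_eq1 n2 n12] := on.
(* The radius at [m] is orthogonal to [v], so [dot c v = dot m v]. *)
have hv : - sin t * dot h e1 + cos t * dot h e2 = 0.
  have -> : - sin t * dot h e1 + cos t * dot h e2 = dot h v.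
    by rewrite vE /circle_dir dotDr !dotZr.
  rewrite hE (dotC q) -vG (dotC v) mE /circle_pt vE /circle_dir !dotE.
  by rewrite n1 n2 n12 (dotC e2 e1) n12; ring.
have CS := cos2Dsin2 t.
rewrite (dot_span h on zE).
rewrite (dot_span h on mE') in hm.
pose k := cos t * dot h e1 + sin t * dot h e2.
have h1 : dot h e1 = k * cos t.
  transitivity ((cos t ^+ 2 + sin t ^+ 2) * dot h e1); first by rewrite CS mul1r.
  transitivity (k * cos t - sin t * (- sin t * dot h e1 + cos t * dot h e2)).
    by rewrite /k; ring.
  by rewrite hv mulr0 subr0.
have h2 : dot h e2 = k * sin t.
  transitivity ((cos t ^+ 2 + sin t ^+ 2) * dot h e2); first by rewrite CS mul1r.
  transitivity (k * sin t + cos t * (- sin t * dot h e1 + cos t * dot h e2)).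
    by rewrite /k; ring.
  by rewrite hv mulr0 addr0.
suff k0 : k = 0 by rewrite h1 h2 k0; ring.
move: hm; rewrite h1 h2.
have -> : k * cos t * dot m e1 + k * sin t * dot m e2 =
   k * (cos t * dot m e1 + sin t * dot m e2) by ring.
move/eqP; rewrite mulf_eq0 => /orP[/eqP //|/eqP mn].
(* If [m] is orthogonal to the radius at [m], the line from the origin to [m] touches the circle
   there, which happens only on the unit sphere. *)
move: m1; suff -> : dot m m = 1 by rewrite ltxx.
have cn : cos t * dot c e1 + sin t * dot c e2 = - r.
  move: mn; rewrite mE /circle_pt !dotE n1 n2 n12 (dotC e2 e1) n12 => mn.
  have -> : r = r * (cos t ^+ 2 + sin t ^+ 2) by rewrite CS mulr1.
  by move: mn; lra.
have : 1 + dot m m = 2 * (dot c c + r * (cos t * dot c e1 + sin t * dot c e2)).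
  by rewrite mc mE /circle_pt !dotE.
by rewrite cn cc; lra.
Qed.

(** By injectivity of [arsinh], squaring reduces the equality to [|x - m|^2 / (1 - |x|^2) = |m -
    y|^2 / (1 - |y|^2)]. *)
Lemma hdist_eq x y m : uball x -> uball y -> uball m ->
  hdist x m = hdist m y ->
  (dot x x - dot y y) * (1 + dot m m) =
  2 * dot ((1 - dot y y) *: x - (1 - dot x x) *: y) m.
Proof.
move=> /uballE hx /uballE hy /uballE hm /mulfI; rewrite pnatr_eq0 => /(_ isT).
move/(can_inj (@arsinhK R)); rewrite !enorm_sq => e.
have x0 : 0 < 1 - dot x x by rewrite subr_gt0.
have y0 : 0 < 1 - dot y y by rewrite subr_gt0.
have m0 : 0 < 1 - dot m m by rewrite subr_gt0.
have := congr1 (fun s => s ^+ 2) e.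
rewrite !expr_div_n !enorm_sq !sqr_sqrtr ?mulr_ge0 ?ltW // => /eqP.
rewrite eqr_div ?mulf_neq0 ?lt0r_neq0 // => /eqP {}e.
have {e} : dot (x - m) (x - m) * (1 - dot y y) = dot (m - y) (m - y) * (1 - dot x x).
  by apply: (mulIf (lt0r_neq0 m0)); lra.
by rewrite !dotE (dotC m x) (dotC m y); lra.
Qed.

(** The equidistance equation passes from [L] to its closure by continuity; on the unit sphere
    [1 + |u|^2 = 2] makes it linear. *)
Lemma bisector_endpoint x y (L : set 'rV[R]_n) u :
  uball x -> uball y -> hbisector x y L ->
  closure L u -> dot u u = 1 ->
  dot ((1 - dot y y) *: x - (1 - dot x x) *: y) u = dot x x - dot y y.
Proof.
move=> hx hy [gL [M [m [gM Mx My [sm dm] [v [v' [tL tM vv']]]]]] _] Lu uu.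
have LB z : L z -> uball z.
  case: gL => [[e /enorm_eq1 ee ->] [t /= t1 <-]|[c [r [e1 [e2 [_ ->]]]]] []//].
  by apply/uballE; rewrite !dotE ee; nra.
have um : uball m by apply: LB; case: tL.
have mB := hdist_eq hx hy um dm.
have dE : dot x x - dot y y = (1 - dot y y) - (1 - dot x x) by ring.
rewrite dE in mB *.
have vG := gradient_along_geodesic Mx My tM mB vv'.
have LE := geodesic_sub_bisector um tL mB vG.
set q := (_ - _ : 'rV[R]_n) in mB vG LE *; set d := _ - _ in mB vG LE *.
pose f z := d * (1 + dot z z) - 2 * dot q z.
have fc : continuous f.
  have c1 : continuous (fun z : 'rV[R]_n => 1 + dot z z : R^o).
    move=> z; apply: (@continuousD R R^o _ (fun=> 1) (fun z : 'rV[R]_n => dot z z)).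
      exact: cst_continuous.
    exact: sqnorm_continuous.
  have c2 : continuous (fun z : 'rV[R]_n => d * (1 + dot z z) : R^o).
    move=> z; apply: (@continuousM R _ (fun=> d) (fun z : 'rV[R]_n => 1 + dot z z)).
      exact: cst_continuous.
    exact: c1.
  have c3 : continuous (fun z : 'rV[R]_n => 2 * dot q z : R^o).
    move=> z; apply: (@continuousM R _ (fun=> 2) (fun z : 'rV[R]_n => dot q z)).
      exact: cst_continuous.
    exact: dot_continuous.
  by move=> z; exact: (continuousB (c2 z) (c3 z)).
have : f u = 0 by apply: (closure_zeros fc _ Lu) => z /LE; rewrite /f => ->; rewrite subrr.
by rewrite /f uu; lra.
Qed.

End Bisector.

(** * Comparison of the boundary points and conclusion *)

(* The endpoint lying on the side of the line [x y] away from the origin is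
   extremal. *)
Lemma extremal_endpoint (R : realType) (n : nat) (P : 'M[R]_(2, n))
    (x y u w : 'rV[R]_n) :
  let q := (1 - dot y y) *: x - (1 - dot x x) *: y in
  let d := dot x x - dot y y in
  let maximal v := forall z, dot z z = 1 -> angle x z y <= angle x v y in
  uball x -> uball y -> x <> y -> u <> w ->
  (x <= P)%MS -> (y <= P)%MS -> (u <= P)%MS -> (w <= P)%MS ->
  dot u u = 1 -> dot w w = 1 -> dot q u = d -> dot q w = d ->
  (maximal u \/ maximal w) /\ (x = - y -> maximal u /\ maximal w).
Proof.
move=> q d maximal /uballE hx /uballE hy /eqP xy uw xP yP uP wP uu ww qu qw.
pose l := enorm (x - y).
have l0 : 0 < l by rewrite sqrtr_gt0 lt_neqAle dot_ge0 eq_sym dot_eq0 subr_eq0 xy.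
have ln0 : l != 0 by rewrite gt_eqF.
pose e := l^-1 *: (x - y).
have ee : dot e e = 1.
  rewrite /e dotZl dotZr mulrA -invfM -expr2 enorm_sq mulVf //.
  by rewrite dot_eq0 subr_eq0.
have xye : x - y = l *: e by rewrite scalerA divff // scale1r.
have eP : (e <= P)%MS by rewrite scalemx_sub // addmx_sub ?eqmx_opp.
clearbody e.
(* If [u] and [w] were both multiples of [e], then [w = - u], so [d = 0]; then [q] is a nonzero
   multiple of [e] and cannot be orthogonal to [u]. *)
have [N [NN eN PE]] : exists N, [/\ dot N N = 1, dot e N = 0 &
    forall z, (z <= P)%MS -> z = dot z e *: e + dot z N *: N].
  have [uE|] := eqVneq u (dot u e *: e); last exact: plane_frame.
  have [wE|] := eqVneq w (dot w e *: e); last exact: plane_frame.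
  exfalso; move: uw uu ww qu qw; rewrite uE wE !dotZl !dotZr ee.
  move: (dot u e) (dot w e) => s s' ss /eqP s1 /eqP s'1 qs qs'.
  have neq : s != s' by apply/eqP => h; apply: ss; rewrite h.
  have sN : s' = - s.
    move: s1 s'1 neq; rewrite !mulr1 -!expr2 !sqrf_eq1.
    by move=> /orP[] /eqP -> /orP[] /eqP ->; rewrite ?eqxx ?opprK.
  have d0 : d = 0 by move: qs qs'; rewrite sN; lra.
  have s0 : s != 0 by apply/eqP => h; move: s1; rewrite h mul0r eq_sym oner_eq0.
  move: qs; rewrite d0 => /eqP; rewrite mulf_eq0 (negbTE s0) /=.
  have -> : q = (1 - dot y y) *: (x - y).
    by rewrite /q scalerBr; congr (_ - _ *: _); move: d0; rewrite /d; lra.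
  rewrite xye !dotZl ee mulr1 mulf_eq0 (negbTE ln0) orbF => /eqP; lra.
have xyN : dot x N = dot y N.
  apply/eqP; rewrite -subr_eq0 -dotNl -dotDl xye dotZl eN mulr0 //.
have xye0 : dot x e != dot y e.
  by rewrite -subr_eq0 -dotNl -dotDl xye dotZl ee mulr1.
have xE := PE x xP; have yE := PE y yP.
have [uE wE] := (PE u uP, PE w wP); rewrite -xyN in yE.
(* [N'] will be [N] or [- N], whichever has [0 <= dot x N']. *)
have max_side N' v : dot N' N' = 1 -> dot e N' = 0 ->
    x = dot x e *: e + dot x N' *: N' -> y = dot y e *: e + dot x N' *: N' ->
    v = dot v e *: e + dot v N' *: N' -> dot v v = 1 -> dot q v = d ->
    0 <= dot x N' -> dot x N' < dot v N' -> maximal v.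
  move=> NN' eN' xE' yE' vE vv qv x0 xv z zz.
  rewrite xE' yE'; apply: (angle_le_endpoint (e := e) (N := N')) => //.
  - by rewrite -xE'; rewrite subr_gt0.
  - by rewrite -yE'; rewrite subr_gt0.
  by rewrite -xE' -yE' -/q qv /d; ring.
have coord v v' : dot (v *: e + v' *: N) (v *: e + v' *: N) = v ^+ 2 + v' ^+ 2.
  by rewrite !dotE ee NN eN (dotC N e) eN; ring.
have xx : dot x x = dot x e ^+ 2 + dot x N ^+ 2 by rewrite {1 2}xE coord.
have yy : dot y y = dot y e ^+ 2 + dot x N ^+ 2 by rewrite {1 2}yE coord.
have a0 : 0 < 1 - dot x e ^+ 2 - dot x N ^+ 2 by lra.
have b0 : 0 < 1 - dot y e ^+ 2 - dot x N ^+ 2 by lra.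
have orth v : v = dot v e *: e + dot v N *: N -> dot q v = d ->
    let a := 1 - dot x e ^+ 2 - dot x N ^+ 2 in
    let b := 1 - dot y e ^+ 2 - dot x N ^+ 2 in
    (b * dot x e - a * dot y e) * dot v e + (b - a) * dot x N * dot v N = b - a.
  move=> vE qv a b; have -> : b - a = d by rewrite /d xx yy /a /b; ring.
  rewrite -[RHS]qv [in RHS]vE dotDr !dotZr /q !dotDl !dotNl !dotZl -xyN xx yy /a /b.
  by rewrite /d xx yy; ring.
have sep : (dot u N - dot x N) * (dot w N - dot x N) < 0.
  apply: (@endpoints_separated R (dot x e) (dot y e) _ (dot u e) _ (dot w e)) => //.
  - by rewrite -coord -uE.
  - by rewrite -coord -wE.
  - exact: orth.
  - exact: orth.
  by case=> h1 h2; apply: uw; rewrite uE wE h1 h2.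
have above v : (v <= P)%MS -> dot v v = 1 -> dot q v = d ->
    0 <= dot x N -> dot x N < dot v N -> maximal v.
  by move=> /PE vE vv qv; exact: (max_side N).
have below v : (v <= P)%MS -> dot v v = 1 -> dot q v = d ->
    dot x N <= 0 -> dot v N < dot x N -> maximal v.
  have flip z : dot z (- N) *: - N = dot z N *: N.
    by rewrite dotNr scaleNr scalerN opprK.
  move=> /PE vE vv qv x0 xv; apply: (max_side (- N)); rewrite ?flip //.
  - by rewrite dotNl dotNr opprK.
  - by rewrite dotNr eN oppr0.
  - by rewrite dotNr oppr_ge0.
  by rewrite !dotNr ltrN2.
have opposite : (dot x N < dot u N /\ dot w N < dot x N) \/
                (dot x N < dot w N /\ dot u N < dot x N).
  have [h|h|h] := ltgtP (dot x N) (dot u N).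
  - by left; split=> //; move: h sep; rewrite -subr_gt0 => h; rewrite (pmulr_rlt0 _ h) subr_lt0.
  - by right; split=> //; move: h sep; rewrite -subr_lt0 => h; rewrite (nmulr_rlt0 _ h) subr_gt0.
  by move: sep; rewrite h subrr mul0r ltxx.
split.
  have [x0|x0] := leP 0 (dot x N).
    by case: opposite => -[h _]; [left|right]; exact: above.
  by case: opposite => -[_ h]; [right|left]; apply: below => //; exact: ltW.
(* The line through [x] and [y] now contains the origin, so either side of it qualifies for [above]
   or [below]. *)
move=> xNy; have x0 : dot x N = 0 by move: xyN; rewrite xNy dotNl; lra.
have xge : 0 <= dot x N by rewrite x0.
have xle : dot x N <= 0 by rewrite x0.
by case: opposite => -[h h']; split; [exact: above|exact: below|exact: below|exact: above].
Qed.

(** The angle at [u] both belongs to the set and bounds it, which gives the nonemptiness and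
    boundedness that [sup] requires. *)
Lemma visual_angle_max (R : realType) (n : nat) (G : set 'rV[R]_n) x y u :
  boundary G u -> (forall z, boundary G z -> angle x z y <= angle x u y) ->
  visual_angle G x y = angle x u y.
Proof.
move=> Gu um; apply/eqP; rewrite eq_le; apply/andP; split.
  by apply: ge_sup; [exists (angle x u y), u | move=> _ [z Gz <-]; exact: um].
apply: ub_le_sup; last by exists u.
by exists (angle x u y) => _ [z Gz <-]; exact: um.
Qed.

Theorem theorem3p2 (R : realType) (n : nat) (hn : (2 <= n)%N)
    (x y : 'rV[R]_n) (hx : uball x) (hy : uball y) (hxy : x <> y)
    (L : set 'rV[R]_n) (hL : hbisector x y L)
    (u w : 'rV[R]_n) (huw : geodesic_endpoints L u w) :
  [/\ extremal (@uball R n) x y u \/ extremal (@uball R n) x y w,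
      x = - y ->
        visual_angle (@uball R n) x y = angle x u y /\
        visual_angle (@uball R n) x y = angle x w y
    & x <> - y ->
        visual_angle (@uball R n) x y =
        Num.max (angle x u y) (angle x w y)].
Proof.
have [_ _ [P [xP yP LP]]] := hL.
case: huw => uw Luw.
have [Lu bu] : (closure L `&` boundary (@uball R n)) u by rewrite Luw; left.
have [Lw bw] : (closure L `&` boundary (@uball R n)) w by rewrite Luw; right.
have uu := boundary_uball bu; have ww := boundary_uball bw.
have [uP wP] := (closure_submx LP Lu, closure_submx LP Lw).
have qu := bisector_endpoint hx hy hL Lu uu.
have qw := bisector_endpoint hx hy hL Lw ww.
have [one both] := extremal_endpoint hx hy hxy uw xP yP uP wP uu ww qu qw.
have bd v : (forall z, dot z z = 1 -> angle x z y <= angle x v y) ->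
    forall z, boundary (@uball R n) z -> angle x z y <= angle x v y.
  by move=> vm z /boundary_uball; exact: vm.
split.
- by case: one => /bd h; [left|right]; split=> //; rewrite (visual_angle_max _ h).
- by move=> /both [/bd hu /bd hw]; rewrite {1}(visual_angle_max bu hu) (visual_angle_max bw hw).
- move=> _; case: one => /bd h.
    by rewrite (visual_angle_max bu h) max_l // h.
  by rewrite (visual_angle_max bw h) max_r // h.
Qed.
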